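(* Let $(\Sigma,F)$ be a partial cellular automaton. Then $(\Sigma,F)$ is nilpotent if and only if it is limit-nilpotent.
   Context: Let $A$ be a finite alphabet and $\mathbb M\in\{\mathbb N,\mathbb Z\}$; $A^{\mathbb M}$ carries the product topology of the discrete topology, and the shift is $\sigma(x)_i=x_{i+1}$. A subshift is a nonempty closed set $\Sigma\subseteq A^{\mathbb M}$ with $\sigma(\Sigma)\subseteq\Sigma$ if $\mathbb M=\mathbb N$, and $\sigma(\Sigma)=\Sigma$ if $\mathbb M=\mathbb Z$. A partial cellular automaton (PCA) is a pair $(\Sigma,F)$ with $\Sigma$ a subshift and $F:\Sigma\to\Sigma$ continuous with $F\sigma=\sigma F$. The limit set is $\Omega_F=\bigcap_{j\in\mathbb N}F^j(\Sigma)$. $(\Sigma,F)$ is nilpotent if there are $z\in\Sigma$ and $q\in\mathbb N$ such that $F^t(\Sigma)=\{z\}$ for all $t\ge q$; it is limit-nilpotent if $\Omega_F=\{z\}$ for some $z\in\Sigma$. *)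

(* Defs.v *)
From mathcomp Require Import all_boot all_algebra.
From mathcomp Require Import all_classical all_reals all_analysis.

Set Implicit Arguments.
Unset Strict Implicit.
Unset Printing Implicit Defensive.

Local Open Scope classical_set_scope.

Variant monoid_index := Naturals | Integers.

Definition index_type (M : monoid_index) : countType :=
  match M with Naturals => nat | Integers => int end.

Definition index_succ (M : monoid_index) : index_type M -> index_type M :=
  match M with
  | Naturals => fun i : nat => i.+1
  | Integers => fun i : int => (i + 1)%R
  end.

Definition config (A : finType) (M : monoid_index) : Type :=
  prod_topology (fun _ : index_type M => discrete_topology A).

Definition shift_map (A : finType) (M : monoid_index) (x : config A M) :
    config A M :=
  fun i => x (index_succ i).

Definition subshift (A : finType) (M : monoid_index) (S : set (config A M)) :
    Prop :=
  [/\ S !=set0,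
      closed S &
      match M with
      | Naturals => @shift_map A M @` S `<=` S
      | Integers => @shift_map A M @` S = S
      end].

Lemma subshift_stable (A : finType) (M : monoid_index) (S : set (config A M)) :
  subshift S -> forall x, S x -> S (shift_map x).
Proof.
case: M S => S [_ _ sS] x Sx; first by apply: sS; exists x.
by rewrite -sS; exists x.
Qed.

Definition subshift_shift (A : finType) (M : monoid_index)
    (S : set (config A M)) (hS : subshift S) (x : S) : S :=
  SigSub (mem_set (subshift_stable hS (set_valP x))).

(* In [pca_space -> pca_space] the set stands for the subtype of its elements,
   whose topology is the one induced by the product topology of [config A M]. *)
Record pca (A : finType) (M : monoid_index) := PCA {
  pca_space : set (config A M);
  pca_subshift : subshift pca_space;
  pca_map : pca_space -> pca_space;
  pca_continuous : continuous pca_map;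
  pca_shift : forall x : pca_space,
    pca_map (subshift_shift pca_subshift x)
    = subshift_shift pca_subshift (pca_map x)
}.

Definition pca_image (A : finType) (M : monoid_index) (P : pca A M) (t : nat) :
    set (pca_space P) :=
  iter t (@pca_map A M P) @` setT.

Arguments pca_image {A M} P t.

Definition limit_set (A : finType) (M : monoid_index) (P : pca A M) :
    set (pca_space P) :=
  \bigcap_(j in [set: nat]) pca_image P j.

Arguments limit_set {A M} P.

Definition pca_nilpotent (A : finType) (M : monoid_index) (P : pca A M) :
    Prop :=
  exists (z : pca_space P) (q : nat),
    forall t : nat, (q <= t)%N -> pca_image P t = [set z].

Definition pca_limit_nilpotent (A : finType) (M : monoid_index) (P : pca A M) :
    Prop :=
  exists z : pca_space P, limit_set P = [set z].

(* Main.v *)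
Require Import Defs.
From mathcomp Require Import all_boot all_algebra.
From mathcomp Require Import all_classical all_reals all_analysis.

(** Nilpotency gives limit-nilpotency at once: the images of the iterates
    decrease, so once they are constantly equal to a singleton, that singleton
    is their intersection.

    Conversely, let the limit set be [{z}].  The space of the automaton is
    compact and Hausdorff, so the images of the iterates form a decreasing
    sequence of compact sets with intersection [{z}], and one of them lies in
    any given neighbourhood of [z] ([iter_image_sub_open]).  For the cylinder of
    the configurations that agree with [z] at the origin, this yields [q] such
    that every [F^q(x)] has the symbol [z_0] at the origin.  As [F^q] commutes
    with the shift and every cell can be moved to the origin inside the subshift
    (in the two-sided case because the shift is onto), every [F^q(x)] has the
    symbol [z_0] everywhere ([constant_symbol_of_origin]).  Therefore all the
    points of [F^q(Sigma)], and [z] among them, are the same constant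
    configuration. *)

Set Implicit Arguments.
Unset Strict Implicit.
Unset Printing Implicit Defensive.

Local Open Scope classical_set_scope.

(** A filter on the subtype is pushed forward to the ambient space; a cluster
    point there, which lies in [K], is a cluster point for the induced
    topology, because induced neighbourhoods are traces of ambient ones. *)
Lemma compact_set_type (X : topologicalType) (K : set X) :
  compact K -> compact [set: K].
Proof.
move=> cK F FF _.
have FK : (set_val @ F) K.
  rewrite /= nbhs_simpl; apply: (@filterS _ F _ setT); last exact: filterT.
  by move=> y _; exact: set_valP.
have [x [Kx clx]] := cK (set_val @ F) _ FK.
exists (SigSub (mem_set Kx)); split=> // B N FB [_ [[W oW <-] Wx sWN]].
have FvB : (set_val @ F) (set_val @` B).
  rewrite /= nbhs_simpl; apply: (@filterS _ F _ B) => // b Bb; by exists b.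
have [] := clx _ W FvB; first exact: open_nbhs_nbhs.
by move=> _ [[b Bb <-] Wb]; exists b; split=> //; exact: sWN.
Qed.

Lemma hausdorff_injective (X Y : topologicalType) (f : X -> Y) :
  continuous f -> injective f -> hausdorff_space Y -> hausdorff_space X.
Proof.
move=> cf injf hY p q clpq; apply: injf; apply: hY => B C Bp Cq.
by have [x [? ?]] := clpq _ _ (cf p _ Bp) (cf q _ Cq); exists (f x).
Qed.

Lemma iter_image_subset (T : Type) (f : T -> T) (m n : nat) :
  (m <= n)%N -> iter n f @` setT `<=` iter m f @` setT.
Proof.
move=> mn _ [x _ <-]; exists (iter (n - m) f x) => //.
by rewrite -iterD subnKC.
Qed.

Lemma iter_continuous (X : topologicalType) (f : X -> X) (n : nat) :
  continuous f -> continuous (iter n f).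
Proof.
move=> cf; elim: n => [|n IHn] x; first exact: cvg_id.
exact: (@continuous_comp _ _ _ (iter n f) f x (IHn x) (cf _)).
Qed.

(** The parts of the images that lie outside [U] decrease; were they all
    nonempty, they would generate a proper filter, with a cluster point by
    compactness.  The images are closed, so that point would lie in all of them
    and outside [U]. *)
Lemma iter_image_sub_open (X : topologicalType) (f : X -> X) (U : set X) :
  compact [set: X] -> hausdorff_space X -> continuous f -> open U ->
  \bigcap_(n in [set: nat]) (iter n f @` setT) `<=` U ->
  exists n, iter n f @` setT `<=` U.
Proof.
move=> cX hX cf oU capU; apply: contrapT => noU.
pose K n := iter n f @` setT `&` ~` U.
have K0 n : K n !=set0.
  have /existsNP[x /not_implyP[fx Ux]] : ~ (iter n f @` setT `<=` U).
    by move=> fU; apply: noU; exists n.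
  by exists x.
have FF : ProperFilter (filter_from setT K).
  apply: filter_from_proper => //.
  apply: filter_fromT_filter; first by exists 0%N.
  move=> i j; exists (maxn i j) => x [fx Ux].
  by split; split=> //; apply: iter_image_subset fx; rewrite ?leq_maxl ?leq_maxr.
have [x [_ clx]] := cX _ FF filterT.
have clK n : closed (K n).
  apply: closedI; last exact: open_closedC.
  apply: compact_closed => //; apply: continuous_compact => //.
  exact/continuous_subspaceT/iter_continuous.
have Kx n : K n x.
  by apply: (clK n) => B Bx; apply: clx => //; exists n.
by have [_] := Kx 0%N; apply; apply: capU => n _; case: (Kx n).
Qed.

Definition origin (M : monoid_index) : index_type M :=
  match M with Naturals => 0%N | Integers => 0%R end.

Section CellularAutomaton.
Variables (A : finType) (M : monoid_index) (P : pca A M).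

Lemma config_compact : compact [set: config A M].
Proof.
have := @tychonoff (index_type M) (fun=> discrete_topology A) (fun=> setT).
rewrite (_ : [set f | _] = setT); last exact/seteqP.
by apply=> i; apply: finite_compact; exact: (@finite_finset A).
Qed.

Lemma config_hausdorff : hausdorff_space (config A M).
Proof. by apply: hausdorff_product => i; exact: discrete_hausdorff. Qed.

Lemma pca_space_compact : compact [set: pca_space P].
Proof.
apply: compact_set_type; apply: subclosed_compact config_compact _ => //.
by case: (pca_subshift P).
Qed.

Lemma set_val_continuous : continuous (set_val : pca_space P -> config A M).
Proof. exact: initial_continuous. Qed.

Lemma pca_space_hausdorff : hausdorff_space (pca_space P).
Proof.
exact: hausdorff_injective set_val_continuous val_inj config_hausdorff.
Qed.

Lemma open_cylinder (i : index_type M) (a : A) :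
  open [set x : pca_space P | (set_val x : config A M) i = a].
Proof.
have cv : continuous (proj i \o (set_val : pca_space P -> config A M)).
  move=> x; apply: continuous_comp; first exact: set_val_continuous.
  exact: proj_continuous.
have /continuousP/(_ [set a]) := cv; apply; exact: discrete_open.
Qed.

Lemma iter_pca_shift (t : nat) (x : pca_space P) :
  iter t (@pca_map A M P) (subshift_shift (pca_subshift P) x) =
  subshift_shift (pca_subshift P) (iter t (@pca_map A M P) x).
Proof. by elim: t => //= t ->; rewrite pca_shift. Qed.

Lemma pca_image_nonempty (t : nat) : pca_image P t !=set0.
Proof.
have [[x Sx] _ _] := pca_subshift P.
by exists (iter t (@pca_map A M P) (SigSub (mem_set Sx))); eexists.
Qed.

End CellularAutomaton.

Lemma subshift_shift_surj (A : finType) (S : set (config A Integers))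
    (hS : subshift S) (x : S) : exists y, subshift_shift hS y = x.
Proof.
have [_ _ sS] := hS; have := set_valP x; rewrite -{1}sS => -[y Sy yx].
by exists (SigSub (mem_set Sy)); apply: val_inj.
Qed.

(** Moving one cell to the right costs one application of the shift to the
    argument; over the integers, moving one cell to the left costs the choice
    of a preimage of the argument. *)
Lemma constant_symbol_of_origin (A : finType) (M : monoid_index)
    (S : set (config A M)) (hS : subshift S) (G : S -> S) (a : A) :
  (forall x, G (subshift_shift hS x) = subshift_shift hS (G x)) ->
  (forall x, (set_val (G x) : config A M) (origin M) = a) ->
  forall x i, (set_val (G x) : config A M) i = a.
Proof.
case: M S hS G => S hS G Gs G0 x i.
  elim: i x => [|i IHi] x; first exact: G0.
  by have := IHi (subshift_shift hS x); rewrite Gs.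
elim/int_rect: i x => [|n IHn|n IHn] x; first exact: G0.
  have := IHn (subshift_shift hS x); rewrite Gs /=.
  by rewrite /shift_map /= -addn1 PoszD.
have [y <-] := subshift_shift_surj hS x.
rewrite Gs -[RHS](IHn y) /=; rewrite /shift_map /=; congr (set_val (G y) _).
by rewrite /index_succ -addn1 PoszD GRing.opprD GRing.addrNK.
Qed.

Theorem proposition14 (A : finType) (M : monoid_index) (P : pca A M) :
  pca_nilpotent P <-> pca_limit_nilpotent P.
Proof.
split=> [[z [q Pq]]|[z limz]]; exists z.
  apply/seteqP; split=> [x /(_ q I)|_ -> j _]; first by rewrite Pq.
  apply: (iter_image_subset (leq_maxl j q)).
  have : [set z] z by [].
  by rewrite -(Pq (maxn j q)) ?leq_maxr.
pose a : A := (set_val z : config A M) (origin M).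
have [q qa] : exists q, pca_image P q `<=`
    [set x | (set_val x : config A M) (origin M) = a].
  apply: iter_image_sub_open.
  - exact: pca_space_compact.
  - exact: pca_space_hausdorff.
  - exact: pca_continuous.
  - exact: open_cylinder.
  - by rewrite -/(limit_set P) limz => _ ->.
have cst x i : (set_val (iter q (@pca_map A M P) x) : config A M) i = a.
  apply: constant_symbol_of_origin (@iter_pca_shift A M P q) _ x i => y.
  by apply: qa; exists y.
have [w _ wz] : pca_image P q z.
  have : limit_set P z by rewrite limz.
  exact.
have imz t : (q <= t)%N -> pca_image P t `<=` [set z].
  move=> qt y ty; have [x _ <-] := iter_image_subset qt ty; rewrite -wz.
  apply: val_inj; apply: funext => i; exact: etrans (cst x i) (esym (cst w i)).
exists q => t qt; apply/seteqP; split; first exact: imz.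
by have [y ty] := pca_image_nonempty P t; move=> _ ->; rewrite -(imz t qt y ty).
Qed.
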